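(* Let $n,k$ be integers with $1\le k\le n-1$ and let $r_1\ge r_2\ge\cdots\ge r_n\ge 0$. Consider the booby trap search game with $n$ boxes, rewards $r_1,\dots,r_n$ and $k$ booby traps played on the complete $1$-uniform hypergraph on $[n]$. Define $$t^*\equiv\arg\max_{t=k,\dots,n}V(t),$$ where, for $t=k,k+1,\dots,n$, $$V(t)\equiv(t-k)\,\lambda([t]),\qquad \lambda([t])=\Big(\sum_{i=1}^t \frac1{r_i}\Big)^{-1}.$$ Then: (i) the Searcher mixed strategy $\mathbf x^{[t^*]}$ that opens box $j$ with probability $\lambda([t^*])/r_j$ for $j\in[t^*]$, and with probability $0$ for $j\notin[t^*]$, is optimal for the Searcher; (ii) for the Hider, any strategy that distributes the $k$ booby traps among the boxes in $[t^*]$ in such a way that box $j\in[t^*]$ contains a booby trap with probability $$y_j\equiv 1-\frac{V(t^* )}{r_j}$$ is optimal; (iii) the value of the game is $V(t^* )$.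
   Context: Notation: $[t]=\{1,\dots,t\}$. The booby trap search game: there are $n$ boxes, identified with the vertex set $[n]$ of a hypergraph $G$ with set of hyperedges $E\subseteq 2^{[n]}$. Box $i$ contains a reward $r_i\ge 0$. A Hider pure strategy is a set $H\in[n]^{(k)}=\{H\subseteq[n]:|H|=k\}$ (the booby trapped boxes). A Searcher pure strategy is a hyperedge $S\in E$ (the boxes opened). The payoff (to the maximizing Searcher, in a zero-sum game against the minimizing Hider) is $R(S,H)=r(S):=\sum_{i\in S}r_i$ if $S\cap H=\emptyset$, and $R(S,H)=0$ otherwise. Mixed strategies are probability distributions over pure strategies, and payoffs extend by expectation. Value and optimal strategies are in the usual sense for finite two-person zero-sum games. In the complete $1$-uniform hypergraph, the hyperedges are exactly all the singletons $\{j\}$, $j\in[n]$; thus the Searcher opens exactly one box, and a Searcher mixed strategy is a probability vector $\mathbf x\in\mathbb R^n$. *)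

(* Defs.v *)
From mathcomp Require Import all_boot all_order all_algebra.
From mathcomp Require Import reals constructive_ereal.

Set Implicit Arguments.
Unset Strict Implicit.
Unset Printing Implicit Defensive.

Import Order.TTheory GRing.Theory Num.Theory.
Local Open Scope ring_scope.

(* Boxes are 'I_n, numbered from 0: the element i : 'I_n is box i + 1.
   A pure strategy of either player is a set of boxes. *)

Definition complete1 (n : nat) : {set {set 'I_n}} :=
  [set [set j] | j : 'I_n].

Definition ksets (n k : nat) : {set {set 'I_n}} :=
  [set H : {set 'I_n} | #|H| == k].

Definition mixed (R : realType) (n : nat) (A : {set {set 'I_n}})
    (p : {ffun {set 'I_n} -> R}) : Prop :=
  [/\ forall S, 0 <= p S,
      forall S, S \notin A -> p S = 0
    & \sum_(S in A) p S = 1].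

(* The probability that the random set drawn from p contains box j. *)
Definition box_prob (R : realType) (n : nat)
    (p : {ffun {set 'I_n} -> R}) (j : 'I_n) : R :=
  \sum_(S : {set 'I_n} | j \in S) p S.

Definition payoff (R : realType) (n : nat) (r : 'I_n -> R)
    (S H : {set 'I_n}) : R :=
  if [disjoint S & H] then \sum_(i in S) r i else 0.

Definition expected_payoff (R : realType) (n : nat) (r : 'I_n -> R)
    (p q : {ffun {set 'I_n} -> R}) : R :=
  \sum_(S : {set 'I_n}) \sum_(H : {set 'I_n}) p S * q H * payoff r S H.

Definition searcher_secures (R : realType) (n k : nat) (r : 'I_n -> R)
    (E : {set {set 'I_n}}) (p : {ffun {set 'I_n} -> R}) (v : R) : Prop :=
  mixed E p /\ forall q, mixed (ksets n k) q -> v <= expected_payoff r p q.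

Definition hider_secures (R : realType) (n k : nat) (r : 'I_n -> R)
    (E : {set {set 'I_n}}) (q : {ffun {set 'I_n} -> R}) (v : R) : Prop :=
  mixed (ksets n k) q /\ forall p, mixed E p -> expected_payoff r p q <= v.

Definition game_value (R : realType) (n k : nat) (r : 'I_n -> R)
    (E : {set {set 'I_n}}) (v : R) : Prop :=
  (exists p, searcher_secures k r E p v) /\ (exists q, hider_secures k r E q v).

Definition searcher_optimal (R : realType) (n k : nat) (r : 'I_n -> R)
    (E : {set {set 'I_n}}) (p : {ffun {set 'I_n} -> R}) : Prop :=
  exists2 v, game_value k r E v & searcher_secures k r E p v.

Definition hider_optimal (R : realType) (n k : nat) (r : 'I_n -> R)
    (E : {set {set 'I_n}}) (q : {ffun {set 'I_n} -> R}) : Prop :=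
  exists2 v, game_value k r E v & hider_secures k r E q v.

(* The t boxes of smallest index, i.e. [t] = {1, ..., t} with boxes numbered
   from 1. *)
Definition first_boxes (n t : nat) : {set 'I_n} := [set i : 'I_n | (i < t)%N].

(* Computed in the extended reals, where 0^-1 = +oo and +oo^-1 = 0: a box of
   reward 0 in a nonempty set A makes lambda r A = 0. *)
Definition lambda (R : realType) (n : nat) (r : 'I_n -> R)
    (A : {set 'I_n}) : R :=
  fine ((\sum_(i in A) (r i)%:E^-1)^-1)%E.

Definition V (R : realType) (n k : nat) (r : 'I_n -> R) (t : nat) : R :=
  (t%:R - k%:R) * lambda r (first_boxes n t).

Definition is_argmax_V (R : realType) (n k : nat) (r : 'I_n -> R)
    (t : nat) : Prop :=
  (k <= t <= n)%N /\ forall s : nat, (k <= s <= n)%N -> V k r s <= V k r t.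

(* In this and the next definition, the prescribed probability of a box is
   imposed only when r j != 0. If some box j < t has r j = 0, then
   lambda r (first_boxes n t) = V k r t = 0 and the quotients lambda / r j and
   V / r j are the indeterminate 0 / 0; no constraint is put on that box. *)
Definition searcher_formula (R : realType) (n : nat) (r : 'I_n -> R)
    (t : nat) (p : {ffun {set 'I_n} -> R}) : Prop :=
  [/\ mixed (complete1 n) p,
      forall j : 'I_n, j \in first_boxes n t -> r j != 0 ->
        box_prob p j = lambda r (first_boxes n t) / r j
    & forall j : 'I_n, j \notin first_boxes n t -> box_prob p j = 0].

Definition hider_formula (R : realType) (n k : nat) (r : 'I_n -> R)
    (t : nat) (q : {ffun {set 'I_n} -> R}) : Prop :=
  [/\ mixed (ksets n k) q,
      forall H, q H != 0 -> H \subset first_boxes n t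
    & forall j : 'I_n, j \in first_boxes n t -> r j != 0 ->
        box_prob q j = 1 - V k r t / r j].

(* Main.v *)
(* Let t maximize V. Against a Searcher opening box j with probability x_j and
   a Hider trapping it with probability y_j, the payoff is the sum of the
   x_j r_j (1 - y_j). The prescribed x makes x_j r_j equal to lambda on [t], so
   the payoff is at least lambda (t - k), since the y_j sum to k. The prescribed
   y makes r_j (1 - y_j) equal to V(t) on [t]. Comparing V(t) with V(t - 1) and
   V(t + 1), which are related by mediants, shows V(t) <= r_j on [t], so that
   y_j lies in [0, 1], and r_j <= V(t) off [t], so that no box pays more than
   V(t). Any vector in [0, 1]^n with sum k is the vector of marginals of a
   random k-set: it is integral, or a convex combination of two such vectors
   with fewer coordinates strictly between 0 and 1. *)
Require Import Defs.
From mathcomp Require Import all_boot all_order all_algebra.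
From mathcomp Require Import reals constructive_ereal.
From mathcomp Require Import ring lra.

Set Implicit Arguments.
Unset Strict Implicit.
Unset Printing Implicit Defensive.

Import Order.TTheory GRing.Theory Num.Theory.
Local Open Scope ring_scope.

(** * Extended-real arithmetic behind [lambda] *)

Lemma lambda_neq0 (R : realType) (n : nat) (r : 'I_n -> R) (A : {set 'I_n}) :
  {in A, forall i, r i != 0} -> lambda r A = (\sum_(i in A) (r i)^-1)^-1.
Proof.
move=> r0; rewrite /lambda -fine_invr -sumEFin; congr (fine (_^-1)%E).
by apply: eq_bigr => i /r0 /negPf r_i; rewrite inver r_i.
Qed.

(** The term of box [i] is [+oo]. The other terms are nonnegative, so their sum is not [-oo], the
    total is [+oo] and its inverse is 0. *)
Lemma lambda_eq0 (R : realType) (n : nat) (r : 'I_n -> R) (A : {set 'I_n})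
    (i : 'I_n) :
  (forall j, 0 <= r j) -> i \in A -> r i = 0 -> lambda r A = 0.
Proof.
move=> r_ge0 iA ri0; rewrite /lambda (bigD1 i) //= ri0 inve0 addye.
  by rewrite invey.
rewrite gt_eqF // (lt_le_trans (ltNyr (0 : R))) //; apply: sume_ge0 => j _.
by rewrite inve_ge0 lee_fin.
Qed.

Lemma lambda_ge0 (R : realType) (n : nat) (r : 'I_n -> R) (A : {set 'I_n}) :
  (forall j, 0 <= r j) -> 0 <= lambda r A.
Proof.
move=> r_ge0; apply: fine_ge0; rewrite inve_ge0.
by apply: sume_ge0 => i _; rewrite inve_ge0 lee_fin.
Qed.

(** * Marginals of mixed strategies and the payoff through them *)

(** Lets facts about mixed strategies on [m]-sets serve both players, with [m] equal to 1 for the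
    Searcher. *)
Lemma complete1E (n : nat) : complete1 n = ksets n 1.
Proof.
apply/setP => S; rewrite inE; apply/imsetP/cards1P => [[j _ ->]|[j ->]].
  by exists j.
by exists j.
Qed.

Lemma mixed_sum1 (R : realType) (n : nat) (A : {set {set 'I_n}})
    (p : {ffun {set 'I_n} -> R}) : mixed A p -> \sum_S p S = 1.
Proof.
case=> _ p0 <-; rewrite [RHS]big_mkcond; apply: eq_bigr => S _.
by case: ifPn => // /p0.
Qed.

Lemma box_prob_ge0 (R : realType) (n : nat) (A : {set {set 'I_n}})
    (p : {ffun {set 'I_n} -> R}) (j : 'I_n) : mixed A p -> 0 <= box_prob p j.
Proof. by case=> p_ge0 _ _; apply: sumr_ge0. Qed.

Lemma box_prob_compl (R : realType) (n : nat) (A : {set {set 'I_n}})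
    (p : {ffun {set 'I_n} -> R}) (j : 'I_n) :
  mixed A p -> 1 - box_prob p j = \sum_(S : {set 'I_n} | j \notin S) p S.
Proof.
move=> /mixed_sum1 <-; rewrite (bigID (fun S : {set 'I_n} => j \in S)) /=.
by rewrite [LHS]addrC addKr.
Qed.

Lemma box_prob_le1 (R : realType) (n : nat) (A : {set {set 'I_n}})
    (p : {ffun {set 'I_n} -> R}) (j : 'I_n) : mixed A p -> box_prob p j <= 1.
Proof.
by move=> pA; rewrite -subr_ge0 (box_prob_compl j pA) sumr_ge0 //; case: pA.
Qed.

(** Double counting: each set in the support is counted once for each of its [m] elements. *)
Lemma sum_box_prob (R : realType) (n m : nat) (p : {ffun {set 'I_n} -> R}) :
  mixed (ksets n m) p -> \sum_j box_prob p j = m%:R.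
Proof.
move=> pm; rewrite /box_prob (exchange_big_dep xpredT) //=.
transitivity (m%:R * \sum_S p S); last by rewrite (mixed_sum1 pm) mulr1.
rewrite mulr_sumr; apply: eq_bigr => S _.
rewrite sumr_const -[LHS]mulr_natl; have [_ p0 _] := pm.
have [|/p0 ->] := boolP (S \in ksets n m); last by rewrite !mulr0.
by rewrite inE => /eqP <-.
Qed.

(** The Searcher draws only singletons, so sums over [S] become sums over boxes; opening box [j]
    pays [r j] exactly when [H] avoids [j]. *)
Lemma expected_payoffE (R : realType) (n : nat) (r : 'I_n -> R)
    (B : {set {set 'I_n}}) (p q : {ffun {set 'I_n} -> R}) :
  mixed (complete1 n) p -> mixed B q ->
  expected_payoff r p q =
    \sum_j box_prob p j * (r j * (1 - box_prob q j)).
Proof.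
move=> pm qm; have [_ p0 _] := pm.
have big_complete1 (P : pred {set 'I_n}) (F : {set 'I_n} -> R) :
    \sum_(S | P S) p S * F S = \sum_(j | P [set j]) p [set j] * F [set j].
  rewrite (bigID (mem (complete1 n))) /= [X in _ + X]big1 ?addr0; last first.
    by move=> S /andP[_ /p0 ->]; rewrite mul0r.
  rewrite big_mkcond [RHS]big_mkcond /=.
  transitivity (\sum_(S in complete1 n) if P S then p S * F S else 0).
    by rewrite [RHS]big_mkcond; apply: eq_bigr => S _; case: (P S); case: ifP.
  by rewrite big_imset //= => i j _ _ /set1_inj.
transitivity (\sum_S p S * \sum_H q H * payoff r S H).
  apply: eq_bigr => S _; rewrite mulr_sumr.
  by apply: eq_bigr => H _; rewrite mulrA.
rewrite (big_complete1 xpredT); apply: eq_bigr => j _; congr (_ * _).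
  under [RHS]eq_bigr => S _ do rewrite -[p S]mulr1.
  rewrite (big_complete1 (fun S => j \in S) (fun=> 1)).
  rewrite (bigD1 j) ?set11 //= mulr1 big1 ?addr0 // => i.
  by rewrite inE eq_sym => /andP[/eqP ->]; rewrite eqxx.
rewrite (box_prob_compl j qm) mulr_sumr [RHS]big_mkcond; apply: eq_bigr => H _.
by rewrite /payoff disjoints1 big_set1; case: ifP; rewrite ?mulr0 // mulrC.
Qed.

(** * Realizing a vector as marginals of a random set of fixed size *)

(* Moving mass from coordinate [j] to coordinate [i] until one of them becomes
   [0] or [1] preserves the total and makes one more coordinate integral. *)
Lemma transfer_mass (R : realFieldType) (n : nat) (y : 'I_n -> R)
    (i j : 'I_n) :
  (forall l, 0 <= y l <= 1) -> i != j -> 0 < y i < 1 -> 0 < y j < 1 ->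
  exists2 a, 0 < a &
    let y' l := y l + a * ((l == i)%:R - (l == j)%:R) in
    [/\ forall l, 0 <= y' l <= 1, \sum_l y' l = \sum_l y l
      & (#|[set l | (0 < y' l < 1)%R]| < #|[set l | (0 < y l < 1)%R]|)%N].
Proof.
move=> y01 ij /andP[yi0 yi1] /andP[yj0 yj1].
pose a := Num.min (1 - y i) (y j).
have a0 : 0 < a by rewrite lt_min subr_gt0 yi1.
have ai : a <= 1 - y i by rewrite ge_min lexx.
have aj : a <= y j by rewrite ge_min lexx orbT.
exists a => // y'.
have y'i : y' i = y i + a by rewrite /y' eqxx (negPf ij) subr0 mulr1.
have y'j : y' j = y j - a.
  by rewrite /y' eqxx eq_sym (negPf ij) sub0r mulrN mulr1.
have y'l l : l != i -> l != j -> y' l = y l.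
  by move=> /negPf li /negPf lj; rewrite /y' li lj subrr mulr0 addr0.
have sum_ind l : \sum_(m < n) (m == l)%:R = 1 :> R.
  by rewrite (bigD1 l) //= eqxx big1 ?addr0 // => m /negPf ->.
split=> [l||].
- have [->|li] := eqVneq l i; first by rewrite y'i; apply/andP; split; lra.
  have [->|lj] := eqVneq l j; first by rewrite y'j; apply/andP; split; lra.
  by rewrite y'l.
- by rewrite big_split /= -mulr_sumr sumrB !sum_ind subrr mulr0 addr0.
- apply/proper_card/properP; split.
    apply/subsetP => l; rewrite !inE.
    have [->|li] := eqVneq l i; first by rewrite yi0 yi1.
    have [->|lj] := eqVneq l j; first by rewrite yj0 yj1.
    by rewrite y'l.
  have [aE|aE] : a = 1 - y i \/ a = y j.
    by rewrite /a /Num.min; case: ifP; [left|right].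
  + by exists i; rewrite !inE ?yi0 ?yi1 // y'i aE addrC subrK ltxx andbF.
  + by exists j; rewrite !inE ?yj0 ?yj1 // y'j aE subrr ltxx.
Qed.

Lemma exists_mixed_box_prob (R : realType) (n m : nat) (y : 'I_n -> R) :
  (forall l, 0 <= y l <= 1) -> \sum_l y l = m%:R ->
  exists2 q, mixed (ksets n m) q & forall l, box_prob q l = y l.
Proof.
have [c] := ubnP #|[set l | 0 < y l < 1]|.
elim: c y => // c IH y; rewrite ltnS => leyc y01 sumy.
pose frac2 (ij : 'I_n * 'I_n) :=
  [&& ij.1 != ij.2, 0 < y ij.1 < 1 & 0 < y ij.2 < 1].
have [[i j] /and3P[/= ij yi yj]|nofrac] := pickP frac2.
  have [a a0 [y1_01 sumy1 lty1]] := transfer_mass y01 ij yi yj.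
  have ji : j != i by rewrite eq_sym.
  have [b b0 [y2_01 sumy2 lty2]] := transfer_mass y01 ji yj yi.
  have [|q1 [q1_ge0 q1_0 q1_1] q1y] := IH _ (leq_trans lty1 leyc) y1_01.
    by rewrite sumy1.
  have [|q2 [q2_ge0 q2_0 q2_1] q2y] := IH _ (leq_trans lty2 leyc) y2_01.
    by rewrite sumy2.
  have ab : a + b != 0 by rewrite gt_eqF // addr_gt0.
  (* The two vectors displace [y] in opposite directions by [a] and [b]; the crossed weights make
     the displacements cancel. *)
  pose q := [ffun S : {set 'I_n} => b / (a + b) * q1 S + a / (a + b) * q2 S].
  exists q.
    split=> [S|S SA|].
    - rewrite ffunE addr_ge0 // mulr_ge0 // divr_ge0 ?addr_ge0 //; exact: ltW.
    - by rewrite ffunE q1_0 // q2_0 // !mulr0 addr0.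
    - under eq_bigr => S _ do rewrite ffunE.
      by rewrite big_split /= -!mulr_sumr q1_1 q2_1; field.
  move=> l; rewrite /box_prob.
  under eq_bigr => S _ do rewrite ffunE.
  rewrite big_split /= -!mulr_sumr; move: (q1y l) (q2y l).
  by rewrite /box_prob => -> ->; field.
pose H := [set l | y l == 1].
have integral l : ~~ (0 < y l < 1) -> y l = (l \in H)%:R.
  rewrite inE; have /andP[yl0 yl1] := y01 l.
  rewrite negb_and -!leNgt => /orP[yl|yl].
    have -> : y l = 0 by apply/eqP; rewrite eq_le yl.
    by rewrite eq_sym oner_eq0.
  have -> : y l = 1 by apply/eqP; rewrite eq_le yl1.
  by rewrite eqxx.
have cardH : \sum_l (l \in H)%:R = #|H|%:R :> R.
  rewrite -sum1_card natr_sum [RHS]big_mkcond /=.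
  by apply: eq_bigr => l _; case: (l \in H).
(* With no two fractional coordinates left, a single one would put the total [m] strictly between
   the integers [#|H|] and [#|H|.+1]. *)
have yE l : y l = (l \in H)%:R.
  apply: (integral l); apply/negP => yl; move: sumy.
  have lH : l \notin H by rewrite inE lt_eqF //; case/andP: yl.
  have -> : \sum_j y j = y l + #|H|%:R.
    rewrite (bigD1 l) //= -cardH [in RHS](bigD1 l) //= (negPf lH) add0r.
    congr (_ + _); apply: eq_bigr => j jl; apply: integral.
    by apply/negP => yj; have := nofrac (j, l); rewrite /frac2 /= jl yj yl.
  move=> sumy; have /andP[yl0 yl1] := yl.
  have : (#|H|%:R : R) < m%:R by lra.
  have : (m%:R : R) < #|H|.+1%:R by rewrite -addn1 natrD; lra.
  rewrite !ltr_nat ltnS => mH Hm.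
  by move: (leq_trans Hm mH); rewrite ltnn.
have Hm : #|H| = m.
  apply/eqP; rewrite -(eqr_nat R) -cardH -sumy; apply/eqP.
  by apply: eq_bigr => l _; rewrite yE.
exists [ffun S : {set 'I_n} => (S == H)%:R].
  split=> [S|S SA|].
  - by rewrite ffunE ler0n.
  - rewrite ffunE; case: eqP SA => // ->.
    by rewrite inE Hm eqxx.
  - rewrite (bigD1 H) ?inE ?Hm //= ffunE eqxx big1 ?addr0 // => S.
    by rewrite ffunE => /andP[_ /negPf ->].
move=> l; rewrite /box_prob yE.
under eq_bigr => S _ do rewrite ffunE.
have [lH|lH] := boolP (l \in H).
  by rewrite (bigD1 H) //= eqxx big1 ?addr0 // => S /andP[_ /negPf ->].
by rewrite big1 // => S; case: eqP => // ->; rewrite (negPf lH).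
Qed.

(** * Initial segments of boxes and the sign of [V] *)

Lemma card_first_boxes (n t : nat) : (t <= n)%N -> #|first_boxes n t| = t.
Proof.
move=> tn; rewrite -sum1_card (eq_bigl (fun i : 'I_n => (i < t)%N)) => [|i].
  by rewrite -(big_ord_widen n (fun=> 1%N)) // sum1_card card_ord.
by rewrite inE.
Qed.

Lemma big_first_boxesS (R : nmodType) (n t : nat) (ht : (t < n)%N)
    (F : 'I_n -> R) :
  \sum_(i in first_boxes n t.+1) F i =
    F (Ordinal ht) + \sum_(i in first_boxes n t) F i.
Proof.
rewrite (bigD1 (Ordinal ht)) ?inE //=; congr (_ + _); apply: eq_bigl => i.
by rewrite !inE ltnS -val_eqE /= andbC -ltn_neqAle.
Qed.

Lemma first_boxesS_neq0 (R : realType) (n : nat) (r : 'I_n -> R) (t : nat)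
    (ht : (t < n)%N) :
  (forall i, 0 <= r i) -> (forall i j : 'I_n, (i <= j)%N -> r j <= r i) ->
  r (Ordinal ht) != 0 -> {in first_boxes n t.+1, forall i, r i != 0}.
Proof.
move=> r_ge0 r_noninc rt i; rewrite inE ltnS => it.
by rewrite gt_eqF // (lt_le_trans _ (r_noninc i (Ordinal ht) it)) // lt0r rt /=.
Qed.

Lemma sum_inv_gt0 (R : realType) (n : nat) (r : 'I_n -> R) (t : nat) :
  (0 < t <= n)%N -> (forall i, 0 <= r i) ->
  {in first_boxes n t, forall i, r i != 0} ->
  0 < \sum_(i in first_boxes n t) (r i)^-1.
Proof.
case: t => // t /= tn r_ge0 r_neq0; rewrite (big_first_boxesS tn).
rewrite ltr_wpDr ?sumr_ge0 // => [i _|]; first by rewrite invr_ge0.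
by rewrite invr_gt0 lt0r r_ge0 r_neq0 // inE /=.
Qed.

Lemma V_ge0 (R : realType) (n k : nat) (r : 'I_n -> R) (t : nat) :
  (forall i, 0 <= r i) -> (k <= t)%N -> 0 <= V k r t.
Proof.
by move=> r_ge0 kt; rewrite mulr_ge0 ?lambda_ge0 // subr_ge0 ler_nat.
Qed.

Lemma V_gt0 (R : realType) (n k : nat) (r : 'I_n -> R) (t : nat) :
  (forall i, 0 <= r i) -> (k < t <= n)%N ->
  {in first_boxes n t, forall i, r i != 0} -> 0 < V k r t.
Proof.
move=> r_ge0 /andP[kt tn] r_neq0.
rewrite /V lambda_neq0 // mulr_gt0 ?subr_gt0 ?ltr_nat // invr_gt0.
by rewrite sum_inv_gt0 // tn (leq_ltn_trans _ kt).
Qed.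

(** * Comparing rewards with the maximum of [V] *)

(* [(d + 1) / (a + L)] is the mediant of [1 / a] and [d / L]. *)
Lemma mediant_le (R : realFieldType) (a L d : R) : 0 < a -> 0 < L ->
  (d + 1) / (a + L) <= d / L -> a^-1 <= d / L.
Proof.
move=> a0 L0; rewrite ler_pdivrMr ?addr_gt0 // mulrAC ler_pdivlMr // => h.
by rewrite ler_pdivlMr // mulrC ler_pdivrMr //; lra.
Qed.

Lemma le_mediant (R : realFieldType) (a L d : R) : 0 < a -> 0 < L ->
  d / L <= (d + 1) / (a + L) -> (d + 1) / (a + L) <= a^-1.
Proof.
move=> a0 L0; rewrite ler_pdivrMr // mulrAC ler_pdivlMr ?addr_gt0 // => h.
by rewrite ler_pdivrMr ?addr_gt0 // mulrC ler_pdivlMr //; lra.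
Qed.

(** By monotonicity only the first box off the segment matters; its index is [t] since numbering
    starts at 0. If its reward is nonzero, maximality against [t.+1] is the hypothesis of
    [mediant_le], with [a] the inverse of that reward and [d = t - k]. *)
Lemma argmax_V_ge (R : realType) (n k : nat) (r : 'I_n -> R) (t : nat)
    (j : 'I_n) :
  (0 < k)%N -> (forall i, 0 <= r i) ->
  (forall i j : 'I_n, (i <= j)%N -> r j <= r i) ->
  is_argmax_V k r t -> j \notin first_boxes n t -> r j <= V k r t.
Proof.
move=> k0 r_ge0 r_noninc [/andP[kt tn] Vmax]; rewrite inE -leqNgt => tj.
have ht : (t < n)%N := leq_ltn_trans tj (ltn_ord j).
apply: (le_trans (r_noninc (Ordinal ht) j tj)).
have [->|rt] := eqVneq (r (Ordinal ht)) 0; first exact: V_ge0.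
have r_neq0 := first_boxesS_neq0 r_ge0 r_noninc rt.
have r_neq0' : {in first_boxes n t, forall i, r i != 0}.
  by move=> i; rewrite inE => it; apply: r_neq0; rewrite inE ltnS ltnW.
have := Vmax t.+1; rewrite ht (leq_trans kt) // => /(_ isT).
rewrite /V !lambda_neq0 // (big_first_boxesS ht) -natr1 addrAC => le_med.
rewrite -[leLHS]invrK; apply: mediant_le le_med.
  by rewrite invr_gt0 lt0r rt r_ge0.
by rewrite sum_inv_gt0 // tn (leq_trans k0 kt).
Qed.

Lemma argmax_V_le (R : realType) (n k : nat) (r : 'I_n -> R) (t : nat)
    (j : 'I_n) :
  (0 < k)%N -> (forall i, 0 <= r i) ->
  (forall i j : 'I_n, (i <= j)%N -> r j <= r i) ->
  is_argmax_V k r t -> j \in first_boxes n t -> V k r t <= r j.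
Proof.
move=> k0 r_ge0 r_noninc [/andP[kt tn] Vmax]; rewrite inE => jt.
case: t => // t in kt tn Vmax jt *.
apply: (le_trans _ (r_noninc j (Ordinal tn) jt)).
(* A nonzero value forces nonzero rewards on the segment and [k < t.+1], so [t] is an admissible
   competitor. *)
have [->|{jt}] := eqVneq (V k r t.+1) 0; first exact: r_ge0.
rewrite mulf_eq0 negb_or subr_eq0 eqr_nat => /andP[kt' lambda0].
have r_neq0 : {in first_boxes n t.+1, forall i, r i != 0}.
  by move=> i it; apply: contraNneq lambda0 => ri; rewrite (lambda_eq0 r_ge0 it).
have {kt' lambda0} kt' : (k <= t)%N by rewrite -ltnS ltn_neqAle eq_sym kt' kt.
have r_neq0' : {in first_boxes n t, forall i, r i != 0}.
  by move=> i; rewrite inE => it; apply: r_neq0; rewrite inE ltnS ltnW.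
have := Vmax t; rewrite kt' ltnW // => /(_ isT).
rewrite /V !lambda_neq0 // (big_first_boxesS tn) -natr1 addrAC => le_med.
rewrite -[leRHS]invrK; apply: le_mediant le_med.
  by rewrite invr_gt0 lt0r r_ge0 r_neq0 // inE /=.
by rewrite sum_inv_gt0 // (ltnW tn) (leq_trans k0 kt').
Qed.

(** * What the prescribed strategies guarantee *)

Lemma searcher_formula_secures (R : realType) (n k : nat) (r : 'I_n -> R)
    (t : nat) (p : {ffun {set 'I_n} -> R}) :
  (forall i, 0 <= r i) -> (t <= n)%N ->
  searcher_formula r t p ->
  searcher_secures k r (complete1 n) p (V k r t).
Proof.
move=> r_ge0 tn [pm px _]; split=> // q qm.
rewrite (expected_payoffE r pm qm).
have term_ge0 j : 0 <= box_prob p j * (r j * (1 - box_prob q j)).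
  rewrite mulr_ge0 ?(box_prob_ge0 j pm) // mulr_ge0 // subr_ge0.
  exact: box_prob_le1 qm.
(* If [lambda] vanishes, the target is 0 and nonnegative payoffs suffice; otherwise no reward in the
   segment is 0 and every marginal there is prescribed. *)
have [lambda0|lambda0] := eqVneq (lambda r (first_boxes n t)) 0.
  by rewrite /V lambda0 mulr0 sumr_ge0.
rewrite (bigID (mem (first_boxes n t))) /= -[V k r t]addr0 lerD ?sumr_ge0 //.
under eq_bigr => j jt.
  have rj : r j != 0.
    by apply: contraNneq lambda0 => rj; rewrite (lambda_eq0 r_ge0 jt).
  rewrite px // mulrA divfK //; over.
rewrite /V mulrC -mulr_sumr ler_wpM2l ?lambda_ge0 // sumrB sumr_const.
rewrite card_first_boxes // lerD2l lerN2 -(sum_box_prob qm).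
rewrite [leRHS](bigID (mem (first_boxes n t))) /= lerDl sumr_ge0 // => j _.
exact: box_prob_ge0 qm.
Qed.

Lemma hider_formula_secures (R : realType) (n k : nat) (r : 'I_n -> R)
    (t : nat) (q : {ffun {set 'I_n} -> R}) :
  (0 < k)%N -> (forall i, 0 <= r i) ->
  (forall i j : 'I_n, (i <= j)%N -> r j <= r i) ->
  is_argmax_V k r t -> hider_formula k r t q ->
  hider_secures k r (complete1 n) q (V k r t).
Proof.
move=> k0 r_ge0 r_noninc tmax [qm _ qy]; split=> // p pm.
have V0 : 0 <= V k r t by case: tmax => /andP[kt _] _; exact: V_ge0.
(* The payoff averages over single boxes, so a bound for each box suffices. *)
have bound j : r j * (1 - box_prob q j) <= V k r t.
  have [jt|jt] := boolP (j \in first_boxes n t).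
    have [->|rj] := eqVneq (r j) 0; first by rewrite mul0r.
    by rewrite qy // subKr mulrC divfK.
  apply: le_trans (argmax_V_ge k0 r_ge0 r_noninc tmax jt).
  by rewrite ler_piMr // lerBlDr lerDl (box_prob_ge0 j qm).
have sum_p : \sum_j box_prob p j = 1.
  by rewrite (@sum_box_prob _ _ 1) // -complete1E.
rewrite (expected_payoffE r pm qm) -[leRHS]mul1r -[X in X * _]sum_p mulr_suml.
apply: ler_sum => j _; by rewrite ler_wpM2l ?(box_prob_ge0 j pm).
Qed.

(** * Existence of the prescribed strategies *)

Lemma exists_searcher_formula (R : realType) (n : nat) (r : 'I_n -> R)
    (t : nat) :
  (forall i, 0 <= r i) -> (0 < t <= n)%N -> exists p, searcher_formula r t p.
Proof.
move=> r_ge0 tn.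
suff [x [x_ge0 sumx xE x0]] : exists x : 'I_n -> R,
    [/\ forall j, 0 <= x j, \sum_j x j = 1,
        forall j, j \in first_boxes n t -> r j != 0 ->
          x j = lambda r (first_boxes n t) / r j
      & forall j, j \notin first_boxes n t -> x j = 0].
  have [j||p pm px] := @exists_mixed_box_prob R n 1 x; rewrite -?complete1E //.
    by rewrite x_ge0 -sumx (bigD1 j) //= lerDl sumr_ge0.
  exists p; split=> [|j jt rj|j jt]; rewrite ?complete1E ?px //.
    exact: xE.
  exact: x0.
have [/existsP[i /andP[it /eqP ri]]|/existsPn r_neq0] :=
    boolP [exists i, (i \in first_boxes n t) && (r i == 0)].
  (* A box [i] of reward 0 makes [lambda] vanish, so every box of nonzero reward must get
     probability 0; all the mass can go to [i]. *)
  exists (fun j => (j == i)%:R); split=> [j||j jt rj|j jt].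
  - exact: ler0n.
  - by rewrite (bigD1 i) //= eqxx big1 ?addr0 // => j /negPf ->.
  - rewrite (lambda_eq0 r_ge0 it ri) mul0r.
    by case: (j =P i) rj => // ->; rewrite ri eqxx.
  - by case: (j =P i) jt => // ->; rewrite it.
have {}r_neq0 : {in first_boxes n t, forall i, r i != 0}.
  by move=> i it; have := r_neq0 i; rewrite it.
exists (fun j => if j \in first_boxes n t
                 then lambda r (first_boxes n t) / r j else 0).
split=> [j||j -> //|j /negPf -> //].
  by case: ifP => // _; rewrite divr_ge0 ?lambda_ge0.
rewrite -big_mkcond /= -mulr_sumr lambda_neq0 // mulVf // gt_eqF //.
exact: sum_inv_gt0.
Qed.

Lemma exists_hider_formula (R : realType) (n k : nat) (r : 'I_n -> R)
    (t : nat) :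
  (0 < k < n)%N -> (forall i, 0 <= r i) ->
  (forall i j : 'I_n, (i <= j)%N -> r j <= r i) ->
  is_argmax_V k r t -> exists q, hider_formula k r t q.
Proof.
move=> /andP[k0 kn] r_ge0 r_noninc tmax; have [/andP[kt tn] Vmax] := tmax.
suff [y [y01 sumy yE y0]] : exists y : 'I_n -> R,
    [/\ forall j, 0 <= y j <= 1, \sum_j y j = k%:R,
        forall j, j \in first_boxes n t -> r j != 0 ->
          y j = 1 - V k r t / r j
      & forall j, j \notin first_boxes n t -> y j = 0].
  have [q qm qy] := exists_mixed_box_prob y01 sumy.
  exists q; split=> [//|H|j jt rj]; last by rewrite qy yE.
  (* A box with marginal 0 lies in no set of nonzero probability. *)
  apply: contraR => /subsetPn[j jH /y0]; rewrite -qy => qj0.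
  have [q_ge0 _ _] := qm.
  by rewrite (psumr_eq0P _ qj0).
have [V0|V0] := eqVneq (V k r t) 0.
  (* Value 0 prescribes a certain trap in each box of nonzero reward in the segment. Such boxes are
     all among the first [k], so trapping these works. *)
  exists (fun j => (j \in first_boxes n k)%:R); split=> [j||j jt rj|j].
  - by rewrite ler0n lern1 leq_b1.
  - rewrite -[in RHS](card_first_boxes (ltnW kn)) -sum1_card natr_sum.
    rewrite [RHS]big_mkcond /=.
    by apply: eq_bigr => j _; case: (j \in _).
  - rewrite V0 mul0r subr0 inE; case: ltnP => // kj.
    (* A positive reward outside the first [k] boxes gives [V (k + 1) > 0]. *)
    have rk : r (Ordinal kn) != 0.
      rewrite gt_eqF // (lt_le_trans _ (r_noninc (Ordinal kn) j kj)) //.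
      by rewrite lt0r rj r_ge0.
    have := Vmax k.+1; rewrite leqnSn kn V0 leNgt => /(_ isT) /negP[].
    apply: V_gt0; rewrite ?ltnSn //.
    exact: first_boxesS_neq0 rk.
  - by rewrite !inE -!leqNgt => tj; rewrite ltnNge (leq_trans kt tj).
have lambda0 : lambda r (first_boxes n t) != 0.
  by apply: contraNneq V0 => lambda0; rewrite /V lambda0 mulr0.
have r_neq0 : {in first_boxes n t, forall i, r i != 0}.
  by move=> i it; apply: contraNneq lambda0 => ri; rewrite (lambda_eq0 r_ge0 it).
exists (fun j => if j \in first_boxes n t then 1 - V k r t / r j else 0).
split=> [j||j -> //|j /negPf -> //].
  case: ifP => [jt|_]; last by rewrite lexx ler01.
  rewrite subr_ge0 lerBlDr lerDl divr_ge0 ?V_ge0 // andbT.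
  rewrite ler_pdivrMr ?mul1r ?(argmax_V_le k0) //.
  by rewrite lt0r r_ge0 r_neq0.
(* The sum is [t] minus [V k r t] times the sum of inverse rewards, that is [t - (t - k)]. *)
rewrite -big_mkcond sumrB sumr_const card_first_boxes // -mulr_sumr /V.
rewrite lambda_neq0 // divfK ?subKr // gt_eqF // sum_inv_gt0 //.
by rewrite tn (leq_trans k0 kt).
Qed.

Theorem theorem3 (R : realType) (n k : nat) (r : 'I_n -> R) (tstar : nat)
    (hk : (1 <= k <= n - 1)%N)
    (hr_ge0 : forall i : 'I_n, 0 <= r i)
    (hr_noninc : forall i j : 'I_n, (i <= j)%N -> r j <= r i)
    (htstar : is_argmax_V k r tstar) :
  [/\ (exists p, searcher_formula r tstar p) /\
      (forall p, searcher_formula r tstar p ->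
         searcher_optimal k r (complete1 n) p),
      (exists q, hider_formula k r tstar q) /\
      (forall q, hider_formula k r tstar q ->
         hider_optimal k r (complete1 n) q)
    & game_value k r (complete1 n) (V k r tstar)].
Proof.
have [k0 kn] : (0 < k)%N /\ (k < n)%N.
  case/andP: hk => k0; rewrite subn1 => kn; split=> //.
  have n0 : (0 < n)%N := leq_trans (leq_trans k0 kn) (leq_pred n).
  by rewrite -(ltn_predK n0) ltnS.
have [/andP[kt tn] _] := htstar.
have searcher p := @searcher_formula_secures R n k r tstar p hr_ge0 tn.
have hider q :=
  @hider_formula_secures R n k r tstar q k0 hr_ge0 hr_noninc htstar.
have [|p pE] := @exists_searcher_formula R n r tstar hr_ge0.
  by rewrite tn (leq_trans k0 kt).
have [|q qE] := @exists_hider_formula R n k r tstar _ hr_ge0 hr_noninc htstar.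
  by rewrite k0.
(* Both prescriptions secure the same number, which is therefore the value; each needs a strategy
   that meets it as a witness. *)
have value : game_value k r (complete1 n) (V k r tstar).
  by split; [exists p; apply: searcher | exists q; apply: hider].
split=> //; split; [by exists p| |by exists q|].
  by move=> p' /searcher; exists (V k r tstar).
by move=> q' /hider; exists (V k r tstar).
Qed.
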